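(* Consider a finite MDP $\langle\mathcal S,\mathcal A,(\mathcal A(s),s\in\mathcal S),P,r\rangle$, a horizon $T\ge1$ and $\alpha\in(0,1]$. A policy $u^*\in\mathcal U^{\rm DH}$ is optimal for the finite-horizon VaR maximization MDP, i.e. $\mathrm{VaR}^{u^*}(s_0)=\sup_{u\in\mathcal U^{\rm RH}}\mathrm{VaR}^u(s_0)$ for all $s_0\in\mathcal S$, if and only if $F^*(s_0,\mathrm{VaR}^{u^*}(s_0))\ge\alpha$ for every $s_0\in\mathcal S$, where $F^*(s_0,\lambda_0):=\inf_{u\in\mathcal U^{\rm RH}}F^u(s_0,\lambda_0)$.
   Context: MDP: $\mathcal S$ and $\mathcal A$ are finite sets; $\mathcal A(s)\subseteq\mathcal A$ is the nonempty set of admissible actions in $s$, with $\cup_s\mathcal A(s)=\mathcal A$; $\mathcal K:=\{(s,a):s\in\mathcal S,a\in\mathcal A(s)\}$; $P(\cdot|s,a)$ is a probability distribution on $\mathcal S$ for each $(s,a)\in\mathcal K$; $r:\mathcal K\to\mathbb R$ is the reward function. Policies: $\mathcal U^{\rm RH}$ is the set of randomized history-dependent policies $u=(u_t)_{t}$, where $u_t(\cdot|h_t)$ is a probability distribution on $\mathcal A(s_t)$ for each history $h_t=(s_0,a_0,\dots,s_{t-1},a_{t-1},s_t)\in\mathcal K^t\times\mathcal S$; $\mathcal U^{\rm DH}$ is the subset of deterministic ones ($u_t(h_t)\in\mathcal A(s_t)$). $\mathbb P^u_{s_0}$ is the law of $(s_0,a_0,s_1,a_1,\dots)$ under $u$ started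 from $s_0$. $R_{0:T}:=\sum_{t=0}^{T-1}r(s_t,a_t)$ (the terminal reward is zero); $F^u(s_0,\lambda_0):=\mathbb P^u_{s_0}(R_{0:T}\le\lambda_0)$ for $\lambda_0\in\mathbb R$; $\mathrm{VaR}^u(s_0):=\inf\{\lambda\in\mathbb R:F^u(s_0,\lambda)\ge\alpha\}$. *)

(* Defs.v *)
From HB Require Import structures.
From mathcomp Require Import all_boot all_order all_algebra.
From mathcomp Require Import all_classical all_reals.

Set Implicit Arguments.
Unset Strict Implicit.
Unset Printing Implicit Defensive.

Import Order.TTheory GRing.Theory Num.Theory.
Local Open Scope classical_set_scope.
Local Open Scope ring_scope.

Definition is_distr (R : realType) (X : finType) (p : X -> R) : Prop :=
  (forall x, 0 <= p x) /\ \sum_(x : X) p x = 1.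

Section MDP.
Variable R : realType.

Record mdp := Mdp {
  state : finType;
  action : finType;
  adm : state -> {set action};
  adm_neq0 : forall s, adm s != finset.set0;
  adm_cover : (\bigcup_(s : state) adm s)%SET = finset.setT;
  trans : {x : state * action | x.2 \in adm x.1} -> state -> R;
  trans_distr : forall k, is_distr (trans k);
  reward : {x : state * action | x.2 \in adm x.1} -> R
}.

Variable M : mdp.

Definition sapair : finType :=
  {x : state M * action M | x.2 \in adm x.1}.

Definition st (k : sapair) : state M := (val k).1.
Definition ac (k : sapair) : action M := (val k).2.

(* h.1 lists (s_0, a_0), ..., (s_(t-1), a_(t-1)), and h.2 is s_t. *)
Definition history (t : nat) : finType := (t.-tuple sapair * state M)%type.

Definition hist_pred (t : nat) (h : history t.+1) : history t :=
  ([tuple tnth h.1 (widen_ord (leqnSn t) i) | i < t], st (tnth h.1 ord_max)).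

(* A distribution on adm s is encoded as one on all actions that vanishes
   outside adm s. *)
Record policy := Policy {
  choice_prob : forall t, history t -> action M -> R;
  choice_prob_distr : forall t (h : history t), is_distr (choice_prob h);
  choice_prob_adm : forall t (h : history t) a,
    a \notin adm h.2 -> choice_prob h a = 0
}.

Definition deterministic (u : policy) : Prop :=
  forall t (h : history t), exists2 a, a \in adm h.2 &
    forall b, choice_prob u h b = (b == a)%:R.

(* The mass function of (s_0, a_0, ..., s_(t-1), a_(t-1), s_t), that is, the
   marginal on t-step histories of the law of the trajectory under u from s0. *)
Fixpoint hist_law (u : policy) (s0 : state M) (t : nat) : history t -> R :=
  match t return history t -> R with
  | 0 => fun h => (h.2 == s0)%:R
  | t'.+1 => fun h =>
      hist_law u s0 (hist_pred h)
      * choice_prob u (hist_pred h) (ac (tnth h.1 ord_max))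
      * trans (tnth h.1 ord_max) h.2
  end.

Definition total_reward (T : nat) (h : history T) : R :=
  \sum_(t < T) reward (tnth h.1 t).

Definition cdf (T : nat) (u : policy) (s0 : state M) (l : R) : R :=
  \sum_(h : history T | total_reward h <= l) hist_law u s0 h.

Definition VaR (T : nat) (alpha : R) (u : policy) (s0 : state M) : R :=
  inf [set l : R | alpha <= cdf T u s0 l].

Definition min_cdf (T : nat) (s0 : state M) (l : R) : R :=
  inf [set cdf T u s0 l | u in [set: policy]].

Definition VaR_optimal (T : nat) (alpha : R) (u : policy) : Prop :=
  forall s0 : state M,
    VaR T alpha u s0 = sup [set VaR T alpha v s0 | v in [set: policy]].

End MDP.

(* Main.v *)
(** For a fixed policy, the cdf of the total reward is a step function with
    finitely many jumps, so the infimum defining VaR is attained and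
    [alpha <= F^u(s0, l)] holds exactly when [VaR^u(s0) <= l]. Hence
    [alpha <= F^*(s0, VaR^ustar(s0))] says that [VaR^ustar(s0)] is an upper
    bound of all the [VaR^u(s0)], and it is itself one of these values. *)
Require Import Defs.
From mathcomp Require Import all_boot all_order all_algebra.
From mathcomp Require Import all_classical all_reals.

Import Order.TTheory GRing.Theory Num.Theory.
Local Open Scope classical_set_scope.
Local Open Scope ring_scope.

(** The threshold is the least value of [f] whose cumulative mass reaches [alpha]. *)
Lemma distr_quantile (R : realType) (I : finType) (p f : I -> R) (alpha : R) :
  is_distr p -> 0 < alpha -> alpha <= 1 ->
  exists i0, forall l, (alpha <= \sum_(i | f i <= l) p i) = (f i0 <= l).
Proof.
move=> [p_ge0 p_sum1] alpha_gt0 alpha_le1.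
have F_mono l l' : l <= l' ->
    \sum_(i | f i <= l) p i <= \sum_(i | f i <= l') p i.
  move=> ll'; rewrite [leRHS](bigID (fun i => f i <= l)) /=.
  rewrite (eq_bigl (fun i => (f i <= l') && (f i <= l))) ?lerDl ?sumr_ge0 // => i.
  by case: (leP (f i) l) => [/le_trans->|]; rewrite ?andbF.
case: (pickP (fun _ : I => true)) => [i1 _|I0]; last first.
  by move: p_sum1 => /eqP; rewrite big_pred0 // eq_sym oner_eq0.
(* Everything lies at or below the largest value, so its cumulative mass is 1 and [alpha <= 1] makes
   it a candidate for the minimum. *)
pose imax := [arg max_(i > i1) f i]%O.
have max_ge i : f i <= f imax.
  by rewrite /imax; case: arg_maxP => // j _; apply.
have alpha_max : alpha <= \sum_(i | f i <= f imax) p i.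
  by rewrite (eq_bigl xpredT) ?p_sum1.
exists [arg min_(i < imax | alpha <= \sum_(j | f j <= f i) p j) f i]%O => l.
case: arg_minP => // i0 alpha_i0 i0_min.
apply/idP/idP => [alpha_l|]; last by move/F_mono; apply: le_trans.
(* Below all values the sum is empty, which [0 < alpha] excludes. Otherwise round [l] down to the
   largest value [f j <= l]: the cumulative mass is unchanged, so [j] is a candidate too. *)
case: (pickP (fun i => f i <= l)) => [i2 i2l|none]; last first.
  by move: alpha_l; rewrite big_pred0 // leNgt alpha_gt0.
case: (@arg_maxP _ _ _ i2 (fun i => f i <= l) f i2l) => j jl j_max.
apply: le_trans (jl); apply: i0_min; apply: le_trans alpha_l _.
rewrite (eq_bigl (fun i => f i <= f j)) // => i.
by apply/idP/idP => [/j_max|/le_trans->].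
Qed.

Section VaR.
Variables (R : realType) (M : mdp R).

Lemma sum_history_rcons (t : nat) (F : history M t.+1 -> R) :
  \sum_h F h =
  \sum_(x : t.-tuple (sapair M)) \sum_(k : sapair M) \sum_(s : state M)
    F ([tuple of rcons x k], s).
Proof.
rewrite pair_big pair_big /=.
pose extend (y : t.-tuple (sapair M) * sapair M * state M) : history M t.+1 :=
  ([tuple of rcons y.1.1 y.1.2], y.2).
rewrite (reindex extend) //=.
pose split (h : history M t.+1) :=
  ([tuple tnth h.1 (widen_ord (leqnSn t) i) | i < t], tnth h.1 ord_max, h.2).
exists split => [[[x k] s] _|[h s] _]; rewrite /split /extend /=.
- congr (_, _, _); last by rewrite (tnth_nth k) /= nth_rcons size_tuple ltnn eqxx.
  apply: eq_from_tnth => i; rewrite tnth_mktuple !(tnth_nth k) /=.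
  by rewrite nth_rcons size_tuple ltn_ord.
- congr (_, _); apply: eq_from_tnth => i; rewrite (tnth_nth (tnth h i)) /=.
  rewrite nth_rcons size_tuple card_ord; case: ltnP => [it|ti].
    apply: etrans (nth_mktuple _ _ (Ordinal it)) _.
    by congr tnth; apply: val_inj.
  have /eqP it : i == t :> nat by rewrite eqn_leq ti -ltnS ltn_ord.
  by rewrite it eqxx; congr tnth; apply: val_inj.
Qed.

Lemma hist_pred_rcons (t : nat) (x : t.-tuple (sapair M)) k s :
  hist_pred ([tuple of rcons x k], s) = (x, st k).
Proof.
congr (_, _) => /=; last first.
  by rewrite (tnth_nth k) /= nth_rcons size_tuple ltnn eqxx.
apply: eq_from_tnth => i; rewrite tnth_mktuple !(tnth_nth k) /=.
by rewrite nth_rcons size_tuple ltn_ord.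
Qed.

(** For the total mass, induct on [t]: sum out the last state by [trans], then the last action by
    [choice_prob]. *)
Lemma hist_law_distr (u : policy M) (s0 : state M) (t : nat) :
  is_distr (@hist_law R M u s0 t).
Proof.
split.
  elim: t => [|t IH] h /=; first exact: ler0n.
  by rewrite !mulr_ge0 ?(trans_distr _).1 ?(choice_prob_distr _ _).1.
elim: t => [|t IH].
  rewrite (bigD1 ([tuple], s0)) //= eqxx big1 ?addr0 // => -[x s].
  by case: (eqVneq s s0) => //= ->; rewrite [x]tuple0 => /eqP[].
rewrite sum_history_rcons -[RHS]IH.
transitivity (\sum_(x : t.-tuple (sapair M)) \sum_(s : state M)
                hist_law u s0 (x, s)); last first.
  by rewrite pair_big; apply: eq_bigr => -[].
apply: eq_bigr => x _.
(* [G] is defined on all pairs, so that the sum over admissible pairs can be split into a state sum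
   and an action sum; inadmissible actions contribute 0 by [choice_prob_adm]. *)
pose G (y : state M * action M) :=
  hist_law u s0 (x, y.1) * choice_prob u (x, y.1) y.2.
transitivity (\sum_(k : sapair M) G (val k)).
  apply: eq_bigr => k _.
  transitivity (\sum_(s : state M) G (val k) * trans k s).
    apply: eq_bigr => s _.
    rewrite [LHS]/= hist_pred_rcons.
    by rewrite (tnth_nth k) /= nth_rcons size_tuple ltnn eqxx.
  by rewrite -big_distrr /= (trans_distr k).2 mulr1.
rewrite -(big_sub (fun y : state M * action M => y.2 \in adm y.1) G).
rewrite big_mkcond /= -(pair_bigA _ (fun s a =>
  if a \in adm s then G (s, a) else 0)) /=.
apply: eq_bigr => s _.
rewrite -[RHS]mulr1 -(choice_prob_distr u (x, s)).2 big_distrr /=.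
apply: eq_bigr => a _; case: ifPn => // /(@choice_prob_adm _ _ u _ (x, s)) ->.
by rewrite mulr0.
Qed.

Variables (T : nat) (alpha : R).
Hypotheses (alpha_gt0 : 0 < alpha) (alpha_le1 : alpha <= 1).

Lemma VaR_attained (u : policy M) (s0 : state M) :
  exists h : history M T, VaR T alpha u s0 = total_reward h /\
    forall l, (alpha <= cdf T u s0 l) = (total_reward h <= l).
Proof.
have [h hE] := distr_quantile _ _ _ (@total_reward R M T) _
  (hist_law_distr u s0 T) alpha_gt0 alpha_le1.
(* The set defining VaR is the closed ray starting at [total_reward h]. *)
exists h; split=> //; rewrite /VaR -[RHS](@inf_itv _ +oo%O true) //; congr inf.
by apply/seteqP; split=> l /=; rewrite in_itv /= andbT hE.
Qed.

Lemma le_cdf_VaR (u : policy M) (s0 : state M) (l : R) :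
  (alpha <= cdf T u s0 l) = (VaR T alpha u s0 <= l).
Proof. by have [h [-> ->]] := VaR_attained u s0. Qed.

(** Needed for [sup] to be a genuine supremum. Each VaR is the total reward of one of finitely many
    histories, which gives a bound uniform in the policy. *)
Lemma VaR_has_ubound (s0 : state M) :
  has_ubound [set VaR T alpha v s0 | v in [set: policy M]].
Proof.
exists (\sum_(h : history M T) `|total_reward h|) => _ [v _ <-].
have [h [-> _]] := VaR_attained v s0.
by rewrite (bigD1 h) //= (le_trans (ler_norm _)) // lerDl sumr_ge0.
Qed.

(** For [inf] to be a genuine infimum, the set of cdf values must be nonempty, witnessed by [u0],
    and bounded below, here by 0. *)
Lemma le_min_cdf (u0 : policy M) (s0 : state M) (l : R) :
  alpha <= min_cdf T s0 l <-> forall u : policy M, alpha <= cdf T u s0 l.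
Proof.
split=> [le_inf u|le_all]; last first.
  by apply: lb_le_inf => [|_ [u _ <-] //]; exists (cdf T u0 s0 l), u0.
apply: le_trans le_inf _; apply: ge_inf; last by exists u.
by exists 0 => _ [v _ <-]; apply: sumr_ge0 => h _; apply: (hist_law_distr _ _ _).1.
Qed.

End VaR.

Theorem corollary2 (R : realType) (M : mdp R) (T : nat) (alpha : R)
    (hT : (1 <= T)%N) (alpha_gt0 : 0 < alpha) (alpha_le1 : alpha <= 1)
    (ustar : policy M) (hdet : deterministic ustar) :
  VaR_optimal T alpha ustar <->
  (forall s0 : state M, alpha <= min_cdf T s0 (VaR T alpha ustar s0)).
Proof.
split=> [opt s0|le_min s0].
  (* Policy by policy, the claim becomes that the VaR of [u] is at most the supremum. *)
  apply/(le_min_cdf _ _ _ _ ustar) => u; rewrite le_cdf_VaR // opt.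
  by apply: ub_le_sup; [exact: VaR_has_ubound | exists u].
apply/eqP; rewrite eq_le; apply/andP; split.
  by apply: ub_le_sup; [exact: VaR_has_ubound | exists ustar].
apply: ge_sup => [|_ [u _ <-]]; first by exists (VaR T alpha ustar s0), ustar.
by rewrite -le_cdf_VaR //; apply: (le_min_cdf _ _ _ _ ustar _ _).1.
Qed.
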